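(* Let $(w_j)_{j\ge1}$ be random frequencies, i.e. random variables with values in $(0,1)$ such that $\sum_{j\ge1}w_j=1$ almost surely. Conditionally on $(w_j)_{j\ge1}$, let $X_1,X_2,\dots$ be i.i.d. positive-integer-valued random variables with $P(X_i=j\mid (w_\ell)_{\ell\ge1})=w_j$, and let $K_n$ be the number of distinct values among $X_1,\dots,X_n$. Define the tail mean measure $$\overrightarrow\nu(x)=\mathrm{E}\big(\#\{j\ge1:\ w_j\ge x\}\big),\qquad x\in(0,1].$$ Suppose there exist a function $\ell$ that is slowly varying at zero (i.e. $\ell(\lambda x)/\ell(x)\to1$ as $x\to0$ for every $\lambda>0$) and a constant $c\ge 0$ such that for every $\lambda>0$ $$\frac{\overrightarrow\nu(\lambda x)-\overrightarrow\nu(x)}{\ell(x)}\to c\log\lambda\qquad\text{as }x\to0.$$ Then $$\mathrm{E}(K_n)=\overrightarrow\nu(1/n)-c\gamma\,\ell(1/n)+o(\ell(1/n)),\qquad n\to\infty,$$ where $\gamma$ is the Euler–Mascheroni constant.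
   Context: A function $\ell$ is slowly varying at zero if $\ell(\lambda x)/\ell(x)\to 1$ as $x\to 0$ for all $\lambda>0$. The condition on $\overrightarrow\nu$ is de Haan slow variation at zero with auxiliary function $\ell$. (The paper states $c\ge0$, but applies the theorem also with auxiliary functions such as $\ell(x)=(\log x)^{m+1}$ and constants $c$ of either sign.) *)

(* Defs.v *)
From HB Require Import structures.
From mathcomp Require Import all_boot all_order all_algebra.
From mathcomp Require Import all_classical all_reals all_analysis.
Set Implicit Arguments. Unset Strict Implicit. Unset Printing Implicit Defensive.
Import Order.TTheory GRing.Theory Num.Theory.
Import numFieldNormedType.Exports.
Local Open Scope classical_set_scope.
Local Open Scope ring_scope.

Definition euler_gamma (R : realType) : R :=
  limn (fun n : nat => \sum_(1 <= k < n.+1) (k%:R)^-1 - ln (n%:R : R)).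

Definition slowly_varying0 (R : realType) (l : R -> R) : Prop :=
  forall lam : R, 0 < lam -> (fun x => l (lam * x) / l x) @ at_right (0:R) --> (1:R).

Definition Kn (T : Type) (X : nat -> T -> nat) (n : nat) (om : T) : nat :=
  size (undup [seq X i om | i <- iota 0 n]).

Definition tail_mean (d : measure_display) (T : measurableType d) (R : realType)
  (P : probability T R) (w : nat -> T -> R) (x : R) : R :=
  fine (\int[P]_om (\sum_(j <oo) (if (x <= w j om)%R then 1 else 0)))%E.

Definition EK (d : measure_display) (T : measurableType d) (R : realType)
  (P : probability T R) (X : nat -> T -> nat) (n : nat) : R :=
  fine (\int[P]_om ((Kn X n om)%:R : R)%:E)%E.

Definition random_frequencies (d : measure_display) (T : measurableType d)
  (R : realType) (P : probability T R) (w : nat -> T -> R) : Prop :=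
  (forall j, measurable_fun setT (w j)) /\
  (forall j om, 0 < w j om < 1) /\
  {ae P, forall om, (fun N : nat => \sum_(j < N) w j om) @ \oo --> (1 : R)}.

(* Conditionally on (w_j)_j, the X_i are i.i.d. with P(X_i = j | w) = w_j:
   for every n, every values js, and every cylinder event A of sigma(w),
   P({X_0 = js 0, ..., X_{n-1} = js (n-1)} /\ A) = E[ 1_A * prod_i w_{js i} ].
   (Cylinder events form a pi-system generating sigma(w).) *)
Definition cond_iid (d : measure_display) (T : measurableType d)
  (R : realType) (P : probability T R) (w : nat -> T -> R)
  (X : nat -> T -> nat) : Prop :=
  (forall i j, measurable [set om | X i om = j]) /\
  forall (n : nat) (js : nat -> nat) (m : nat) (B : nat -> set R),
    (forall k, measurable (B k)) ->
    P [set om | (forall i, (i < n)%N -> X i om = js i) /\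
                (forall k, (k < m)%N -> B k (w k om))] =
    (\int[P]_(om in [set om | forall k, (k < m)%N -> B k (w k om)])
        (\prod_(i < n) w (js i) om)%:E)%E.

(* 1/n as a real number (1/0 = 0 by MathComp's convention; irrelevant asymptotically). *)
Definition inv_nat (R : realType) (n : nat) : R := (n%:R)^-1.

(* Main.v *)
Require Import Defs.
From HB Require Import structures.
From mathcomp Require Import all_boot all_order all_algebra.
From mathcomp Require Import all_classical all_reals all_analysis.
From mathcomp Require Import measurable_realfun ring lra zify.

(** Summing over the species, [E K_n] is the expectation of
    [\sum_j (1 - (1 - w_j) ^ n)].  Since [1 - (1 - w) ^ n] is the integral of
    [n (1 - x) ^ (n - 1)] over [0 <= x <= w], Tonelli and the substitution
    [x = u ^ 2 / n] give [E K_n = \int g_n(u) nu(u ^ 2 / n) du] for the probability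
    density [g_n(u) = 2 u (1 - u ^ 2 / n) ^ (n - 1)] on [0 < u <= sqrt n].  The
    fundamental theorem of calculus gives exactly
    [\int g_n(u) ln(u ^ 2) du = ln n - H_n], which tends to [- gamma].  Hence
    [(E K_n - nu(1/n)) / l(1/n) - c (ln n - H_n)] is the integral of [g_n] against
    [(nu(u ^ 2 / n) - nu(1/n)) / l(1/n) - c ln(u ^ 2)], which tends to 0 pointwise.
    Chaining the de Haan condition along the scales [u, 2 u, 4 u, ...] bounds the
    increments by [C (1/u + u + u ^ 2) |l(1/n)|]; after multiplication by [g_n] this
    is dominated by a multiple of [exp(- u)], so dominated convergence applies. *)

Set Implicit Arguments. Unset Strict Implicit. Unset Printing Implicit Defensive.
Import Order.TTheory GRing.Theory Num.Theory.
Import numFieldNormedType.Exports.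
Local Open Scope classical_set_scope.
Local Open Scope ring_scope.

(** * Increments of de Haan functions *)

(** Finitely many multiplications by [q] carry any positive [y] past [a], so [Q] descends towards 0
    one factor [q] at a time. All chaining along geometric scales below goes through this
    induction. *)
Lemma scale_ind (R : realType) (q a : R) (Q : R -> Prop) : 2 <= q -> 0 < a ->
  (forall y, a <= y -> Q y) -> (forall y, 0 < y < a -> Q (q * y) -> Q y) ->
  forall y, 0 < y -> Q y.
Proof.
move=> q2 a0 base step.
suff H n : forall y, 0 < y -> a <= q ^+ n * y -> Q y.
  (* [a / y] is below [2 ^+ Num.bound (a / y)], hence below the same power of [q]. *)
  move=> y y0; apply: (H (Num.bound (a / y))) => //.
  rewrite -ler_pdivrMr//.
  apply: (le_trans (ltW (upper_nthrootP (leqnn _)))).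
  by rewrite lerXn2r// nnegrE; lra.
elim: n => [y y0|n ih y y0 h]; first by rewrite expr0 mul1r; exact: base.
have [/base//|ya] := leP a y.
apply: step; first by rewrite y0.
apply: ih; first by rewrite mulr_gt0//; lra.
by rewrite mulrA -exprSr.
Qed.

Section de_haan_bound.
Variables (R : realType) (nu l : R -> R).
Hypothesis nu_mono : forall x y, 0 < x -> x <= y -> nu y <= nu x.
Hypothesis nu_ge0 : forall x, 0 < x -> 0 <= nu x.
Variables (x0 K : R).
Hypothesis x0_gt0 : 0 < x0.
Hypothesis K_gt0 : 0 < K.
Hypothesis l_down : forall y, 0 < y <= x0 -> `|l (4^-1 * y)| <= 3/2 * `|l y|.
Hypothesis l_up : forall y, 0 < y <= x0 -> `|l (4 * y)| <= 3/2 * `|l y|.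
Hypothesis nu_down : forall y, 0 < y <= x0 ->
  nu (4^-1 * y) - nu y <= K * `|l y|.
Hypothesis nu_up : forall y, 0 < y <= x0 -> nu y - nu (4 * y) <= K * `|l y|.

(** Replacing [u] by [2 * u] and [y] by [4^-1 * y] leaves [u ^+ 2 * y] unchanged. One such step
    costs at most [K * |l y|]. Because 3/2 < 2, [l_down] turns the inductive bound into
    [3 * K * |l y| / u], and the remaining [K * |l y| / u] pays for the step. *)
Let nu_small u y : 0 < u -> u <= 1 -> 0 < y <= x0 ->
  nu (u ^+ 2 * y) - nu y <= 4 * K * `|l y| / u.
Proof.
move=> u0; move: u u0 y.
apply: (@scale_ind _ 2 (2^-1)); [lra|lra| |].
- move=> u hu y u1 /andP[y0 yx].
  have u0 : 0 < u by lra.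
  apply: (@le_trans _ _ (K * `|l y|)).
    apply: le_trans (nu_down _); last by rewrite y0.
    rewrite lerD2r; apply: nu_mono; first by rewrite mulr_gt0//; lra.
    by rewrite ler_wpM2r ?(ltW y0)//; nra.
  have kl0 : 0 <= K * `|l y| by rewrite mulr_ge0// ltW.
  by rewrite ler_pdivlMr// -mulrA; nra.
- move=> u /andP[u0 u2] ih y _ /andP[y0 yx].
  have y40 : 0 < 4^-1 * y <= x0 by apply/andP; split; lra.
  have := ih (4^-1 * y) ltac:(lra) y40.
  rewrite (_ : (2 * u) ^+ 2 * (4^-1 * y) = u ^+ 2 * y); last by field.
  have := nu_down (y := y); rewrite y0 yx => /(_ isT) h1 h2.
  have := l_down (y := y); rewrite y0 yx => /(_ isT) h3.
  have kl0 : 0 <= K * `|l y| by rewrite mulr_ge0// ltW.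
  have h4 : 4 * K * `|l (4^-1 * y)| / (2 * u) <= 3 * K * `|l y| / u.
    rewrite (_ : _ / (2 * u) = 2 * K * `|l (4^-1 * y)| / u); last first.
      by field; rewrite gt_eqF.
    by rewrite ler_pM2r ?invr_gt0//; have := ler_wpM2l (ltW K_gt0) h3; lra.
  have : K * `|l y| <= K * `|l y| / u by rewrite ler_pdivlMr//; nra.
  move: h1 h2 h4; rewrite -!mulrA => h1 h2 h4 h5.
  lra.
Qed.

(** The same chaining in the direction of growing arguments, with [l_up] and [nu_up]. *)
Let nu_large u y : 1 <= u -> 0 < y -> u ^+ 2 * y <= x0 ->
  nu y - nu (u ^+ 2 * y) <= 4 * K * `|l y| * u.
Proof.
move=> u1 y0 yx; have u0 : 0 < u by lra.
(* From here on [u] stands for the inverse of the original variable, so that the descent of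
   [scale_ind] towards 0 reaches arbitrarily large scales. *)
move: u1 yx; rewrite -(invrK u).
have : 0 < u^-1 by rewrite invr_gt0.
move: u^-1 => {u u0} u u0 u1 yx.
move: u u0 y u1 y0 yx.
apply: (@scale_ind _ 2 (2^-1)); [lra|lra| |].
- move=> u hu y u1 y0 yx.
  have u0 : 0 < u by lra.
  have ui2 : u^-1 <= 2 by rewrite -[2]invrK lef_pV2 ?posrE//.
  have yx0 : y <= x0.
    by apply: le_trans yx; rewrite -[leLHS]mul1r ler_wpM2r ?(ltW y0)//; nra.
  apply: (@le_trans _ _ (K * `|l y|)).
    apply: le_trans (nu_up _); last by rewrite y0.
    rewrite lerD2l lerN2; apply: nu_mono; first by rewrite mulr_gt0//; nra.
    by rewrite ler_wpM2r ?(ltW y0)//; nra.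
  have Kl0 : 0 <= K * `|l y| by rewrite mulr_ge0// ltW.
  by have := ler_wpM2l Kl0 u1; lra.
- move=> u /andP[u0 u2] ih y u1 y0 yx.
  have ui2 : 2 <= u^-1 by rewrite -[2]invrK lef_pV2 ?posrE//; lra.
  have y4 : 4 * y <= x0 by apply: le_trans yx; rewrite ler_wpM2r ?(ltW y0)//; nra.
  have E : (2 * u)^-1 ^+ 2 * (4 * y) = u^-1 ^+ 2 * y by field; rewrite gt_eqF.
  have := ih (4 * y); rewrite E => /(_ _ _ yx).
  have -> : (2 * u)^-1 = u^-1 / 2 by field; rewrite gt_eqF.
  move=> /(_ ltac:(lra) ltac:(lra)) h2.
  have := nu_up (y := y); rewrite y0 => /(_ ltac:(lra)) h1.
  have := l_up (y := y); rewrite y0 => /(_ ltac:(lra)) h3.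
  have ly0 := normr_ge0 (l y).
  move: (u^-1) ui2 h2 => v v2 h2.
  have h4 : 4 * K * `|l (4 * y)| * (v / 2) <= 3 * K * `|l y| * v.
    have Kv : 0 <= K * v by rewrite mulr_ge0 ?(ltW K_gt0)//; lra.
    by have := ler_wpM2l Kv h3; lra.
  have Kl0 : 0 <= K * `|l y| by rewrite mulr_ge0// ltW.
  by have := ler_wpM2l Kl0 v2; lra.
Qed.

Variable a : R.
Hypothesis a_gt0 : 0 < a.
Hypothesis a4x0 : 4 * a <= x0.
Hypothesis nua : nu (4 * a) < nu a.

(* [l] may fail to be measurable, so its infimum on [[a, 4a]] is bounded below
   through the increments of the monotone function [nu]. *)
Let l_lower : exists2 m, 0 < m & forall y, 0 < y <= 4 * a -> m * y <= `|l y|.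
Proof.
have := a_gt0; have := a4x0; have := K_gt0 => K0 ax a0.
pose m := (nu a - nu (4 * a)) / (2 * K) / (4 * a).
have m0 : 0 < m by rewrite !divr_gt0 ?subr_gt0 ?mulr_gt0.
exists m => // y /andP[y0]; move: y y0.
apply: (@scale_ind _ 4 a) => //; [lra| |].
(* Since [a <= y <= 4 * a], the interval from [4^-1 * y] to [4 * y] contains the one from [a] to
   [4 * a]. Two increments of size at most [K * |l y|] thus cover the drop [nu a - nu (4 * a)],
   whence the [2 * K] in [m]. *)
- move=> y ay y4.
  have y0 : 0 < y <= x0 by apply/andP; split; lra.
  have h1 := nu_down y0; have h2 := nu_up y0.
  have h3 : nu a <= nu (4^-1 * y) by apply: nu_mono; lra.
  have h4 : nu (4 * y) <= nu (4 * a) by apply: nu_mono; lra.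
  have h5 : nu a - nu (4 * a) <= `|l y| * (2 * K) by lra.
  apply: (@le_trans _ _ (m * (4 * a))); first by rewrite ler_pM2l.
  by rewrite divfK ?gt_eqF ?mulr_gt0// ler_pdivrMr//; lra.
- move=> y /andP[y0 ya] ih _.
  have := ih ltac:(lra).
  have y1 : 0 < y <= x0 by apply/andP; split; lra.
  have := l_up y1; nra.
Qed.

(** There are three regimes: [nu_small] gives the term in [u^-1], [nu_large] the term in [u] as long
    as [u ^+ 2 * y <= x0], and beyond [x0] the linear lower bound on [|l|] gives the term in
    [u ^+ 2]. *)
Lemma de_haan_increment_le : exists2 C, 0 <= C & forall y u, 0 < y <= 4 * a ->
  0 < u -> `|nu (u ^+ 2 * y) - nu y| <= C * (u^-1 + u + u ^+ 2) * `|l y|.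
Proof.
have [m m0 lm] := l_lower.
have := a_gt0; have := a4x0; have := K_gt0; have := x0_gt0 => x00 K0 ax a0.
pose D := nu x0 / m / x0.
have D0 : 0 <= D by rewrite !divr_ge0 ?nu_ge0 ?ltW.
exists (4 * K + D); first by lra.
move=> y u /andP[y0 ya] u0.
have ly0 := normr_ge0 (l y).
have ui0 : 0 < u^-1 by rewrite invr_gt0.
have u20 : 0 < u ^+ 2 by rewrite exprn_gt0.
have uy0 : 0 < u ^+ 2 * y by rewrite mulr_gt0.
have yx0 : y <= x0 by lra.
have Kl0 : 0 <= K * `|l y| by rewrite mulr_ge0// ltW.
have Dl0 : 0 <= D * `|l y| by rewrite mulr_ge0.
have -> : (4 * K + D) * (u^-1 + u + u ^+ 2) * `|l y| =
    4 * (K * `|l y|) * u^-1 + 4 * (K * `|l y|) * u + 4 * (K * `|l y|) * u ^+ 2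
    + D * `|l y| * u^-1 + D * `|l y| * u + D * `|l y| * u ^+ 2 by ring.
have Kv := mulr_ge0 Kl0 (ltW ui0); have Ku := mulr_ge0 Kl0 (ltW u0).
have Ku2 := mulr_ge0 Kl0 (ltW u20); have Dv := mulr_ge0 Dl0 (ltW ui0).
have Du := mulr_ge0 Dl0 (ltW u0); have Du2 := mulr_ge0 Dl0 (ltW u20).
have [u1|u1] := leP u 1.
  have := nu_small u0 u1 (y := y); rewrite y0 yx0 => /(_ isT) h.
  have h2 : nu y <= nu (u ^+ 2 * y) by apply: nu_mono => //; rewrite ler_piMl ?(ltW y0)//; nra.
  by rewrite ger0_norm ?subr_ge0//; lra.
rewrite ler0_norm; last by rewrite subr_le0 nu_mono// ler_peMl ?(ltW y0)//; nra.
have [xu|xu] := leP (u ^+ 2 * y) x0.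
  by have := nu_large (ltW u1) y0 xu; lra.
(* Chaining is valid only up to [x0], reached at the scale [v]. The rest of the drop is at most
   [nu x0], and [nu x0 <= nu x0 * (u ^+ 2 * y) / x0 = D * (m * y) * u ^+ 2], which [l_lower]
   compares with [|l y|]. *)
pose v := Num.sqrt (x0 / y).
have v2 : v ^+ 2 = x0 / y by rewrite sqr_sqrtr// divr_ge0 ?ltW.
have v2y : v ^+ 2 * y = x0 by rewrite v2 divfK// gt_eqF.
have v0 : 0 <= v by rewrite sqrtr_ge0.
have v1 : 1 <= v.
  by rewrite -(@ler_pXn2r _ 2) ?nnegrE// expr1n v2 ler_pdivlMr// mul1r.
have vu : v <= u.
  rewrite -(@ler_pXn2r _ 2) ?nnegrE ?(ltW u0)// v2 ler_pdivrMr//.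
  exact: ltW.
have h1 := nu_large v1 y0; rewrite v2y in h1.
have {}h1 := h1 (lexx _).
have h2 : K * `|l y| * v <= K * `|l y| * u by rewrite ler_wpM2l.
have h3 := nu_ge0 uy0.
have h4 : nu x0 <= D * `|l y| * u ^+ 2.
  apply: (@le_trans _ _ (D * (m * y) * u ^+ 2)); last first.
    by rewrite ler_wpM2r ?(ltW u20)// ler_wpM2l// lm// y0.
  rewrite (_ : _ * _ = nu x0 * (u ^+ 2 * y) / x0); last first.
    by rewrite /D; field; rewrite !gt_eqF.
  rewrite ler_pdivlMr// ler_wpM2l ?nu_ge0//; exact: ltW.
lra.
Qed.
End de_haan_bound.

Lemma near0_right_le (R : realType) (Q : R -> Prop) :
  (\forall y \near 0^'+, Q y) -> exists2 e : R, 0 < e & forall y, 0 < y <= e -> Q y.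
Proof.
case=> e /= e0 H; exists (e / 2); first by lra.
move=> y /andP[y0 ye]; apply: H => //=.
by rewrite sub0r normrN gtr0_norm//; lra.
Qed.

(** For [lam = 1] the ratio is [l y / l y], which is 0 wherever [l y = 0] since [0^-1 = 0]; yet it
    tends to 1. *)
Lemma slowly_varying0_neq0 (R : realType) (l : R -> R) :
  slowly_varying0 l -> \forall y \near 0^'+, l y != 0.
Proof.
move=> svl.
have : \forall y \near 0^'+, 0 < l (1 * y) / l y.
  exact: (cvgr_gt _ (svl 1 ltr01) 0 ltr01).
apply: filterS => y; apply: contraTneq => ->.
by rewrite invr0 mulr0 ltxx.
Qed.

(** The limits at the two scales 4 and [4^-1] suffice to supply the hypotheses of
    [de_haan_increment_le]. The resulting bound is uniform in [y], as dominated convergence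
    requires. *)
Lemma de_haan_dominated (R : realType) (nu l : R -> R) (c : R) :
  (forall x y, 0 < x -> x <= y -> nu y <= nu x) ->
  (forall x, 0 < x -> 0 <= nu x) ->
  (forall x, 0 < x -> exists2 y, 0 < y < x & nu x < nu y) ->
  slowly_varying0 l ->
  (forall lam : R, 0 < lam ->
     (fun x => (nu (lam * x) - nu x) / l x) @ at_right (0:R) --> c * ln lam) ->
  exists2 C, 0 <= C & \forall y \near 0^'+, l y != 0 /\ forall u, 0 < u ->
    `|(nu (u ^+ 2 * y) - nu y) / l y| <= C * (u^-1 + u + u ^+ 2).
Proof.
move=> nu_mono nu_ge0 nu_inc svl haan.
have ln0 := slowly_varying0_neq0 svl.
have lq (lam : R) : 0 < lam ->
    \forall y \near 0^'+, `|l (lam * y)| <= 3 / 2 * `|l y|.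
  move=> lam0.
  have h : \forall y \near 0^'+, `|l (lam * y) / l y| <= 3 / 2.
    by apply: (cvgr_norm_le _ (svl _ lam0)); rewrite normr1; lra.
  apply: filterS2 h ln0 => y + y0.
  by rewrite normrM normfV ler_pdivrMr// normr_gt0.
pose K := `|c * ln (4^-1 : R)| + `|c * ln (4 : R)| + 1.
have nq (lam : R) : 0 < lam -> `|c * ln lam| < K ->
    \forall y \near 0^'+, `|nu (lam * y) - nu y| <= K * `|l y|.
  move=> lam0 lamK.
  have h : \forall y \near 0^'+, `|(nu (lam * y) - nu y) / l y| <= K.
    exact: (cvgr_norm_le _ (haan _ lam0)).
  apply: filterS2 h ln0 => y + y0.
  by rewrite normrM normfV ler_pdivrMr// normr_gt0.
have K4 : `|c * ln (4 : R)| < K.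
  by rewrite /K; have := normr_ge0 (c * ln (4^-1 : R)); lra.
have K4V : `|c * ln (4^-1 : R)| < K.
  by rewrite /K; have := normr_ge0 (c * ln (4 : R)); lra.
have K0 : 0 < K by apply: le_lt_trans K4.
have i4 : 0 < 4^-1 :> R by lra.
have p4 : 0 < 4 :> R by lra.
have /near0_right_le[x0 x00 hx0] : \forall y \near 0^'+,
   [/\ l y != 0, `|l (4^-1 * y)| <= 3 / 2 * `|l y|,
       `|l (4 * y)| <= 3 / 2 * `|l y|, `|nu (4^-1 * y) - nu y| <= K * `|l y| &
       `|nu (4 * y) - nu y| <= K * `|l y| ].
  near=> y; split; near: y; [exact: ln0|exact: lq|exact: lq|exact: nq|exact: nq].
(* Without such an [a], chaining by factors of 4 would give [nu b <= nu x0] for all small [b],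
   against [nu_inc] at [x0]. *)
have [a a0 [ax nua]] : exists2 a : R, 0 < a & 4 * a <= x0 /\ nu (4 * a) < nu a.
  apply: contrapT => /forall2NP H.
  have {}H a : 0 < a -> 4 * a <= x0 -> nu a <= nu (4 * a).
    move=> a0 ax; rewrite leNgt; apply/negP => h.
    by have [/(_ a0)|/not_andP[]] := H a.
  have [b /andP[b0 bx]] := nu_inc _ x00; apply/negP; rewrite -leNgt.
  move: b b0 bx; apply: (@scale_ind _ 4 (4^-1 * x0)); [lra|lra| |].
    move=> y xy _; apply: (@le_trans _ _ (nu (4^-1 * x0))).
      by apply: nu_mono => //; lra.
    by apply: (le_trans (H _ _ _)); [lra|lra|rewrite mulrA divff ?mul1r// gt_eqF].
  move=> y /andP[y0 yx] ih _.
  by apply: (le_trans (H _ _ _)) => //; [lra|apply: ih; lra].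
have [C C0 HC] : exists2 C, 0 <= C & forall y u, 0 < y <= 4 * a ->
    0 < u -> `|nu (u ^+ 2 * y) - nu y| <= C * (u^-1 + u + u ^+ 2) * `|l y|.
  apply: (@de_haan_increment_le _ nu l nu_mono nu_ge0 x0 K) => //.
  - by move=> y /hx0[].
  - by move=> y /hx0[].
  - by move=> y /hx0[_ _ _ h _]; apply: le_trans h; exact: ler_norm.
  - by move=> y /hx0[_ _ _ _ h]; apply: le_trans h; rewrite distrC; exact: ler_norm.
exists C => //; near=> y.
have l0 : l y != 0 by near: y.
split=> // u u0; rewrite normrM normfV ler_pdivrMr ?normr_gt0//.
apply: HC => //; apply/andP; split; near: y; first exact: nbhs_right_gt.
by apply: nbhs_right_le; lra.
Unshelve. all: by end_near.
Qed.

(** * The occupancy kernel *)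

Section kernel.
Variable R : realType.
Local Notation mu := (@lebesgue_measure R).

(** At the endpoints [F] need only be continuous, so an antiderivative containing [ln] can be used
    without differentiating it at 0. *)
Lemma continuous_FTC2_restrict (k h F : R -> R) (b : R) : 0 < b ->
  (forall u, k u = if 0 < u <= b then h u else 0) ->
  continuous h -> continuous F ->
  (forall x, 0 < x < b -> is_derive x 1 F (h x)) ->
  mu.-integrable setT (EFin \o k) /\ (\int[mu]_u (k u)%:E = (F b - F 0)%:E)%E.
Proof.
move=> b0 kE ch cF dF.
have E : EFin \o k = (EFin \o h) \_ `]0, b].
  apply/funext => u; rewrite /= patchE kE; case: ifPn => hu.
    by rewrite ifT// inE/= in_itv.
  by rewrite ifF//; apply/negbTE; apply: contra hu; rewrite inE/= in_itv.
have ih : mu.-integrable `[0, b] (EFin \o h).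
  apply: continuous_compact_integrable; first exact: segment_compact.
  exact: continuous_subspaceT.
have ih' : mu.-integrable `]0, b] (EFin \o h).
  by apply: integrableS ih => //; exact: subset_itv_oc_cc.
split; first by rewrite E -integrable_mkcond.
rewrite (_ : (fun _ => _) = EFin \o k)//.
rewrite E -integral_mkcond integral_itv_obnd_cbnd; last exact: measurable_int ih'.
rewrite (@continuous_FTC2 _ h F)// ?EFinB//.
- exact: continuous_subspaceT.
- split.
  + by move=> x; rewrite in_itv/= => /dF[].
  + exact/cvg_at_right_filter/cF.
  + exact/cvg_at_left_filter/cF.
- move=> x; rewrite in_itv/= => /dF dFx.
  by rewrite derive1E; apply: derive_val.
Qed.

(* The density [n (1 - x) ^ (n - 1)] on [[0, 1]] in the variable [u] with
   [x = u ^ 2 / n]; squaring tames the singularity [1 / u] of the bound on the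
   increments of [nu]. *)
Definition occupancy_kernel (n : nat) (u : R) : R :=
  if (0 < u) && (u ^+ 2 <= n%:R) then 2 * u * (1 - u ^+ 2 / n%:R) ^+ n.-1 else 0.

Lemma occupancy_kernel_ge0 n u : 0 <= occupancy_kernel n u.
Proof.
rewrite /occupancy_kernel; case: ifPn => // /andP[u0 un].
rewrite mulr_ge0//; first lra.
rewrite exprn_ge0// subr_ge0; case: n un => [|n] un; first by rewrite invr0 mulr0.
by rewrite ler_pdivrMr ?ltr0n// mul1r.
Qed.

(** This combines [1 - x <= exp (- x)] with [(n - 1) / n >= 1 / 2] for [n > 1]. *)
Lemma occupancy_kernel_le n u : (1 < n)%N ->
  occupancy_kernel n u <= 2 * `|u| * expR (- (u ^+ 2 / 2)).
Proof.
move=> n1; rewrite /occupancy_kernel; case: ifPn => [/andP[u0 un]|_]; last first.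
  by rewrite !mulr_ge0// expR_ge0.
rewrite gtr0_norm// ler_pM2l; last by lra.
have n0 : (0 : R) < n%:R by rewrite ltr0n; apply: ltn_trans n1.
apply: (@le_trans _ _ (expR (- (u ^+ 2 / n%:R)) ^+ n.-1)).
  rewrite lerXn2r ?nnegrE ?expR_ge0 ?expR_ge1Dx//.
  by rewrite subr_ge0 ler_pdivrMr// mul1r.
rewrite -expRM_natl ler_expR mulrN lerN2.
rewrite mulrCA ler_wpM2l ?sqr_ge0// ler_pdivlMr//.
rewrite mulrC ler_pdivrMr//.
by rewrite -natrM ler_nat; case: n n1 {un n0} => [|[|n]]//= _; lia.
Qed.

(** Taken as a polynomial, so that continuity and derivatives reduce to algebra. *)
Let q (n : nat) : {poly R} := 1 - (n%:R^-1)%:P * 'X^2.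

Let qE n u : (q n).[u] = 1 - u ^+ 2 / n%:R.
Proof. by rewrite /q !hornerE /=; ring. Qed.

Let dqE n u : ((q n)^`()).[u] = - (2 * u / n%:R).
Proof.
rewrite /q derivB -polyC1 derivC derivM derivC derivXn mul0r sub0r add0r.
by rewrite !hornerE /=; ring.
Qed.

Let sqrt_bound (n : nat) (w u : R) : (0 < n)%N -> 0 < w ->
  (0 < u <= Num.sqrt (n%:R * w)) = (0 < u) && (u ^+ 2 / n%:R <= w).
Proof.
move=> n0 w0; apply: andb_id2l => u0.
rewrite ler_pdivrMr ?ltr0n// mulrC -[in LHS](ger0_norm (ltW u0)) -sqrtr_sqr.
by rewrite ler_sqrt// ?sqr_ge0// mulr_ge0// ltW.
Qed.

(** The kernel has antiderivative [1 - (1 - u ^+ 2 / n) ^+ n], and the cut-off [u ^+ 2 / n <= w]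
    ends at [b], the square root of [n * w]. The value is the conditional probability that a species
    of frequency [w] appears among [n] draws. *)
Lemma integral_occupancy_kernel_le (n : nat) (w : R) : (0 < n)%N -> 0 < w <= 1 ->
  mu.-integrable setT
    (EFin \o (fun u => if u ^+ 2 / n%:R <= w then occupancy_kernel n u else 0)) /\
  (\int[mu]_u (if u ^+ 2 / n%:R <= w then occupancy_kernel n u else 0)%:E =
   (1 - (1 - w) ^+ n)%:E)%E.
Proof.
move=> n0 /andP[w0 w1].
have nR0 : (0 : R) < n%:R by rewrite ltr0n.
pose b := Num.sqrt (n%:R * w).
have b0 : 0 < b by rewrite sqrtr_gt0 mulr_gt0.
have b2 : b ^+ 2 / n%:R = w.
  by rewrite sqr_sqrtr ?mulr_ge0 ?ltW// mulrC mulKf// gt_eqF.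
pose h := horner (2%:P * 'X * q n ^+ n.-1).
pose F := horner (1 - q n ^+ n).
have [] := @continuous_FTC2_restrict
  (fun u => if u ^+ 2 / n%:R <= w then occupancy_kernel n u else 0) h F b b0.
- move=> u; rewrite sqrt_bound//; case: ltP => u0 /=; last first.
    by rewrite /occupancy_kernel ltNge u0/= if_same.
  case: ifPn => // uw; rewrite /occupancy_kernel u0/= ifT; last first.
    by rewrite -[leRHS]mul1r -ler_pdivrMr// (le_trans uw).
  by rewrite /h hornerM hornerM hornerX hornerC horner_exp qE.
- exact: continuous_horner.
- exact: continuous_horner.
- move=> x _; apply: (is_derive_eq (is_derive_poly _ _)).
  rewrite derivB deriv_exp -polyC1 derivC sub0r hornerN hornerMn hornerM dqE.
  rewrite /h hornerM hornerM hornerX hornerC -mulr_natl.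
  by field; rewrite gt_eqF.
move=> ih ->; split=> //; congr EFin.
rewrite /F !hornerD !hornerN !horner_exp !qE -polyC1 !hornerC b2 expr0n/= mul0r.
by rewrite subr0 expr1n; ring.
Qed.

Lemma integral_occupancy_kernel (n : nat) : (0 < n)%N ->
  mu.-integrable setT (EFin \o occupancy_kernel n) /\
  (\int[mu]_u (occupancy_kernel n u)%:E = 1)%E.
Proof.
move=> n0; have := @integral_occupancy_kernel_le n 1 n0.
have E u : (if u ^+ 2 / n%:R <= 1 then occupancy_kernel n u else 0) =
    occupancy_kernel n u.
  case: ifPn => //; rewrite ler_pdivrMr ?ltr0n// mul1r.
  by rewrite /occupancy_kernel => /negbTE ->; rewrite andbF.
rewrite (funext E) ltr01 lexx => /(_ isT)[i].
under eq_integral do rewrite E.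
move=> ->; split=> //.
by rewrite subrr expr0n; rewrite eqn0Ngt n0 subr0.
Qed.

(** As [ln] is 0 on nonpositive reals, the function vanishes to the left of 0. To the right,
    [ln x <= x] at the inverse of the square root [s] of [y] gives [- s * ln s <= 1], hence
    [|y * ln y| <= 2 * s] for [y <= 1]. *)
Lemma continuous_xlnx : continuous (fun u : R => u * ln u).
Proof.
move=> x; case: (ltgtP x 0) => [x0|x0|->].
- have E : {near x, (fun=> 0 : R) =1 (fun u : R => u * ln u)}.
    near=> y; rewrite ln0 ?mulr0//; apply/ltW; near: y; exact: lt_nbhsl.
  apply: (cvg_trans (near_eq_cvg E)).
  by rewrite ln0 ?(ltW x0)// mulr0; apply: (@cvg_cst R).
- by apply: cvgM; [exact: cvg_id|exact: continuous_ln].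
- rewrite /continuous_at mul0r; apply/cvgr0Pnorm_lt => /= e e0.
  have c2 : 2 * Num.sqrt `|y| @[y --> (0 : R)] --> (0 : R).
    rewrite -[X in _ --> X](_ : 2 * Num.sqrt `|0 : R| = 0); last first.
      by rewrite normr0 sqrtr0 mulr0.
    apply: cvgMr; apply: (@cvg_comp _ _ _ _ _ _ (nbhs `|0 : R|)).
      exact: norm_continuous.
    exact: sqrt_continuous.
  near=> y.
  apply: (@le_lt_trans _ _ (2 * Num.sqrt `|y|)); last first.
    near: y; exact: (cvgr_lt _ c2 e e0).
  have [y0|y0] := leP y 0; first by rewrite ln0// mulr0 normr0 mulr_ge0 ?sqrtr_ge0.
  have y1 : y <= 1.
    apply: (le_trans (ler_norm _)); near: y.
    by apply: (cvgr_norm_le _ cvg_id); rewrite normr0.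
  have s0 : 0 < Num.sqrt y by rewrite sqrtr_gt0.
  have ss : y = Num.sqrt y ^+ 2 by rewrite sqr_sqrtr// ltW.
  have := @ln_sublinear _ (Num.sqrt y)^-1; rewrite invr_gt0 => /(_ s0).
  rewrite lnV ?posrE// => /ltW /(ler_wpM2l (ltW s0)); rewrite divff ?gt_eqF// => h.
  rewrite normrM [X in X * _]gtr0_norm// [in X in _ <= X]gtr0_norm//.
  rewrite ler0_norm ?ln_le0// {1 2}ss lnXn// -mulr_natl.
  by have := ler_wpM2l (ltW s0) h; lra.
Unshelve. all: by end_near.
Qed.

(** Integration by parts: differentiating [(1 - q ^+ n) * (2 * ln u)] leaves the extra term
    [(1 - q ^+ n) * 2 / u]. The geometric sum [G] rewrites it as [(2 * u / n) * G = - q' * G], which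
    the derivative of [S] cancels. At the upper end [q = 0], so [S] vanishes and [ln n] remains; at
    0, [q = 1] and [S] is the harmonic sum. *)
Lemma integral_occupancy_kernel_ln (n : nat) : (0 < n)%N ->
  mu.-integrable setT (EFin \o (fun u => occupancy_kernel n u * ln (u ^+ 2))) /\
  (\int[mu]_u (occupancy_kernel n u * ln (u ^+ 2))%:E =
   (ln n%:R - \sum_(1 <= k < n.+1) k%:R^-1)%:E)%E.
Proof.
move=> n0; have nR0 : (0 : R) < n%:R by rewrite ltr0n.
pose b := Num.sqrt (n%:R : R).
have b0 : 0 < b by rewrite sqrtr_gt0.
have b2 : b ^+ 2 = n%:R by rewrite sqr_sqrtr ?ltW.
pose G : {poly R} := \sum_(i < n) q n ^+ i.
pose S : {poly R} := \sum_(i < n) i.+1%:R^-1 *: q n ^+ i.+1.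
have GE : 1 - q n ^+ n = n%:R^-1%:P * 'X^2 * G.
  have := subrX1 (q n) n; rewrite -/G => e.
  by rewrite -opprB e -mulNr opprB /q opprB addrC subrK.
have SE : S^`() = (q n)^`() * G.
  rewrite /S linear_sum/= mulr_sumr; apply: eq_bigr => i _.
  rewrite derivZ deriv_exp/= -[X in _ *: X]scaler_nat scalerA mulVf ?scale1r//.
pose h := fun u : R => (u * ln u) * (4%:P * q n ^+ n.-1).[u].
pose F := fun u : R => (1 - q n ^+ n).[u] * (2 * ln u) + S.[u].
(* A factor [u] taken out of [1 - q ^+ n] tames [ln u], so that [F] is continuous at 0. *)
have FE : F = fun u : R => (u * ln u) * ((2 / n%:R)%:P * 'X * G).[u] + S.[u].
  apply/funext => u; rewrite /F GE !hornerM !hornerC !hornerX.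
  by ring.
have [] := @continuous_FTC2_restrict
  (fun u => occupancy_kernel n u * ln (u ^+ 2)) h F b b0.
- move=> u; have := sqrt_bound u n0 ltr01; rewrite mulr1 -/b => ->.
  rewrite ler_pdivrMr// mul1r /occupancy_kernel; case: ifPn; last by rewrite mul0r.
  move=> /andP[u0 _]; rewrite lnXn// /h hornerM hornerC horner_exp qE.
  by rewrite -mulr_natl; ring.
- move=> x; apply: cvgM; [exact: continuous_xlnx|exact: continuous_horner].
- rewrite FE => x; apply: cvgD; last exact: continuous_horner.
  apply: cvgM; [exact: continuous_xlnx|exact: continuous_horner].
- move=> x /andP[x0 _].
  have dln := is_derive1_ln x0.
  have d2ln : is_derive x 1 (fun u : R => 2 * ln u) (2 * x^-1).
    exact: (@is_deriveZ _ _ _ (@ln R)).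
  have d1 := @is_deriveM _ _ _ _ _ _ _ _ (is_derive_poly (1 - q n ^+ n) x) d2ln.
  have d2 := is_deriveD d1 (is_derive_poly S x).
  apply: (is_derive_eq d2).
  have -> : ((1 - q n ^+ n)^`()).[x] = 2 * x * (q n ^+ n.-1).[x].
    rewrite derivB deriv_exp -polyC1 derivC sub0r hornerN hornerMn hornerM dqE.
    by rewrite -mulr_natl; field; rewrite gt_eqF.
  rewrite SE GE /h !hornerM !hornerC dqE !hornerX /GRing.scale/=.
  by field; rewrite !gt_eqF.
move=> ih ->; split => //; congr EFin.
rewrite /F !hornerD !hornerN !horner_exp !qE -polyC1 !hornerC b2.
have nn : n%:R / n%:R = 1 :> R by apply: divff; rewrite gt_eqF.
have -> : S.[b] = 0.
  rewrite /S horner_sum big1// => i _.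
  by rewrite hornerZ horner_exp qE b2 nn subrr expr0n mulr0.
have -> : S.[0] = \sum_(1 <= k < n.+1) k%:R^-1.
  rewrite /S horner_sum big_add1 big_mkord; apply: eq_bigr => i _.
  by rewrite hornerZ horner_exp qE expr0n mul0r subr0 expr1n mulr1.
rewrite (@ln0 _ 0)// nn subrr !expr0n eqn0Ngt n0/= mul0r -b2 lnXn//.
by rewrite -mulr_natl; ring.
Qed.
End kernel.

(** [euler_gamma] is a [limn], so convergence must be proved. The sequence decreases because
    [ln (1 - 1/n) <= - 1/n], and it is nonnegative because [ln (1 + 1/n) <= 1/n]. *)
Lemma euler_gamma_cvg (R : realType) :
  (\sum_(1 <= k < n.+1) k%:R^-1 - ln (n%:R : R)) @[n --> \oo] --> euler_gamma R.
Proof.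
pose u n : R := \sum_(1 <= k < n.+1) k%:R^-1 - ln (n%:R : R).
rewrite -[X in X @ _ --> _]/u -[X in _ --> X]/(limn u).
(* The shift skips [u 0 = 0 < u 1 = 1], where monotonicity fails because [ln 0 = 0]. *)
suff /cvg_ex[l ul] : cvgn (fun n => u n.+1).
  have ul' : u @ \oo --> l by rewrite -cvg_shiftS.
  by rewrite (cvg_lim _ ul').
have uS n : u n.+2 <= u n.+1.
  rewrite /u big_nat_recr//=.
  have h : ln (1 + - n.+2%:R^-1) <= - (n.+2%:R^-1 : R).
    by apply: le_ln1Dx; rewrite ltrN2 invf_lt1 ?ltr0n// ltr1n.
  have e : 1 - n.+2%:R^-1 = n.+1%:R / n.+2%:R :> R.
    rewrite -[n.+2]addn1 natrD; have := ltr0Sn R n => n0.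
    by field; rewrite gt_eqF//; lra.
  move: h; rewrite e ln_div ?posrE ?ltr0n//.
  move: (ln n.+1%:R) (ln n.+2%:R) (n.+2%:R^-1) (\sum_(1 <= i < n.+2) _).
  by move=> *; lra.
apply: nonincreasing_is_cvgn.
  by apply/nonincreasing_seqP.
exists 0 => _ [n _ <-]; rewrite /u subr_ge0.
have h m : ln (m.+1%:R : R) <= \sum_(1 <= k < m.+1) k%:R^-1.
  elim: m => [|m ih]; first by rewrite big_geq// ln1.
  rewrite big_nat_recr//=.
  have e : m.+2%:R = m.+1%:R * (1 + m.+1%:R^-1) :> R.
    by rewrite -[m.+2]addn1 natrD mulrDr mulr1 divff// pnatr_eq0.
  rewrite e lnM ?posrE ?ltr0n ?addr_gt0 ?invr_gt0 ?ltr0n// lerD//.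
  by apply: le_ln1Dx; apply: (@lt_le_trans _ _ 0); rewrite ?ltrN10 ?invr_ge0 ?ler0n.
apply: (le_trans (h n)); rewrite [leRHS]big_nat_recr//= lerDl.
by rewrite invr_ge0 ler0n.
Qed.

Lemma normr_ln_le (R : realType) (u : R) : 0 < u -> `|ln u| <= u^-1 + u.
Proof.
move=> u0; have h1 := ln_sublinear u0.
have ui0 : 0 < u^-1 by rewrite invr_gt0.
have := ln_sublinear ui0; rewrite lnV ?posrE// => h2.
by rewrite ler_norml; apply/andP; split; lra.
Qed.

(** The factor [u] of the kernel cancels [u^-1]. Then [(u - 2) ^+ 2 >= 0] gives
    [- u ^+ 2 / 2 <= 2 - 2 * u], and [1 + u ^+ 2 + u ^+ 3 <= 27 * (1 + u / 3) ^+ 3 <= 27 * expR u].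
    The product is [54 * expR (2 - u)], a multiple of the exponential density. *)
Lemma occupancy_kernel_dominated (R : realType) (n : nat) (u : R) : (1 < n)%N ->
  occupancy_kernel n u * (u^-1 + u + u ^+ 2) <=
  54 * expR 2 * exponential_pdf 1 u.
Proof.
move=> n1; have [u0|u0] := leP u 0.
  rewrite /occupancy_kernel ltNge u0/= mul0r.
  by rewrite !mulr_ge0 ?expR_ge0 ?exponential_pdf_ge0.
have ui0 : 0 < u^-1 by rewrite invr_gt0.
apply: (@le_trans _ _ (2 * u * expR (- (u ^+ 2 / 2)) * (u^-1 + u + u ^+ 2))).
  apply: ler_wpM2r; first by have := sqr_ge0 u; lra.
  by have := occupancy_kernel_le u n1; rewrite gtr0_norm.
rewrite exponential_pdfE ?(ltW u0)//= mul1r mulN1r.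
have -> : 2 * u * expR (- (u ^+ 2 / 2)) * (u^-1 + u + u ^+ 2) =
    2 * expR (- (u ^+ 2 / 2)) * (1 + u ^+ 2 + u ^+ 3).
  by field; rewrite gt_eqF.
have h1 : expR (- (u ^+ 2 / 2)) <= expR (2 - 2 * u).
  by rewrite ler_expR; have := sqr_ge0 (u - 2); rewrite sqrrB; lra.
have h2 : 1 + u ^+ 2 + u ^+ 3 <= 27 * expR u.
  have -> : expR u = expR (u / 3) ^+ 3 by rewrite -expRM_natl; congr expR; field.
  apply: (@le_trans _ _ (27 * (1 + u / 3) ^+ 3)).
    rewrite (_ : 27 * _ = 27 + 27 * u + 9 * u ^+ 2 + u ^+ 3); last by field.
    by have := sqr_ge0 u; lra.
  rewrite ler_wpM2l// lerXn2r ?nnegrE ?expR_ge0 ?expR_ge1Dx//; lra.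
have -> : 54 * expR 2 * expR (- u) = 2 * expR (2 - 2 * u) * (27 * expR u).
  rewrite (_ : 54 * _ * _ = 54 * (expR 2 * expR (- u))); last by ring.
  rewrite (_ : 2 * _ * _ = 54 * (expR (2 - 2 * u) * expR u)); last by ring.
  by rewrite -!expRD; congr (_ * expR _); ring.
apply: ler_pM; [| | |exact: h2].
- by rewrite mulr_ge0// expR_ge0.
- by have := exprn_ge0 3 (ltW u0); have := sqr_ge0 u; lra.
- by rewrite ler_wpM2l.
Qed.

(** * Asymptotics of the kernel integral *)

Lemma cvg_invn_at_right0 (R : realType) : (n%:R^-1 : R) @[n --> \oo] --> 0^'+.
Proof.
move=> Q [e /= e0 He]; change (\forall n \near \oo, Q (n%:R^-1 : R)); near=> n.
have n0 : 0 < n%:R^-1 :> R.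
  by rewrite invr_gt0 ltr0n; near: n; exact: nbhs_infty_gt.
apply: He => //=; rewrite sub0r normrN gtr0_norm//.
rewrite invf_plt ?posrE//; last by rewrite -invr_gt0.
by near: n; exact: nbhs_infty_gtr.
Unshelve. all: by end_near.
Qed.

Lemma de_haan_kernel_cvg (R : realType) (nu l : R -> R) (c : R) :
  (forall x y, 0 < x -> x <= y -> nu y <= nu x) ->
  (forall x, 0 < x -> 0 <= nu x) ->
  (forall x, 0 < x -> exists2 y, 0 < y < x & nu x < nu y) ->
  slowly_varying0 l ->
  (forall lam : R, 0 < lam ->
     (fun x => (nu (lam * x) - nu x) / l x) @ at_right (0:R) --> c * ln lam) ->
  (forall n, (0 < n)%N -> (@lebesgue_measure R).-integrable setT
     (EFin \o (fun u => occupancy_kernel n u * nu (u ^+ 2 / n%:R)))) ->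
  (\int[@lebesgue_measure R]_u (occupancy_kernel n u * nu (u ^+ 2 / n%:R))
     - nu n%:R^-1) / l n%:R^-1 @[n --> \oo] --> - (c * euler_gamma R).
Proof.
move=> nu_mono nu_ge0 nu_inc svl haan iA.
have [C C0 nearC] := de_haan_dominated nu_mono nu_ge0 nu_inc svl haan.
have y0n := @cvg_invn_at_right0 R.
have [N _ HN] : \forall n \near \oo, (1 < n)%N /\ (l n%:R^-1 != 0 /\
   forall u, 0 < u -> `|(nu (u ^+ 2 / n%:R) - nu n%:R^-1) / l n%:R^-1| <=
     C * (u^-1 + u + u ^+ 2)).
  near=> n; split; first by near: n; exact: nbhs_infty_gt.
  by near: n; exact: (y0n _ nearC).
pose A n u := occupancy_kernel n u * nu (u ^+ 2 / n%:R).
pose L n (u : R) := occupancy_kernel n u * ln (u ^+ 2).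
(* This linear combination allows termwise integration; the product form [fE] serves for the
   pointwise limit and the domination. *)
pose f n u : R := (l n%:R^-1)^-1 * A n u
   - (nu n%:R^-1 / l n%:R^-1 * occupancy_kernel n u + c * L n u).
have fE n u : f n u = occupancy_kernel n u *
    ((nu (u ^+ 2 / n%:R) - nu n%:R^-1) / l n%:R^-1 - c * ln (u ^+ 2)).
  by rewrite /f /A /L; ring.
have ZlE (a : R) (g : R -> R) : (@lebesgue_measure R).-integrable setT (EFin \o g) ->
   (@lebesgue_measure R).-integrable setT (EFin \o (fun u => a * g u)).
  move=> ig; have -> : EFin \o (fun u => a * g u) = (fun u => a%:E * (EFin \o g) u)%E.
    by apply/funext => u; rewrite /= EFinM.
  exact: integrableZl.
have iK n : (0 < n)%N -> (@lebesgue_measure R).-integrable setT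
    (EFin \o occupancy_kernel n) by move=> n0; case: (integral_occupancy_kernel R n0).
have iL n : (0 < n)%N -> (@lebesgue_measure R).-integrable setT
    (EFin \o L n) by move=> n0; case: (integral_occupancy_kernel_ln R n0).
have iR n : (0 < n)%N -> (@lebesgue_measure R).-integrable setT
    (EFin \o (fun u => nu n%:R^-1 / l n%:R^-1 * occupancy_kernel n u + c * L n u)).
  move=> n0; have := integrableD measurableT (ZlE (nu n%:R^-1 / l n%:R^-1) _ (iK _ n0))
    (ZlE c _ (iL _ n0)).
  by apply: eq_integrable => // u _; rewrite /= EFinD.
have if_ n : (0 < n)%N -> (@lebesgue_measure R).-integrable setT (EFin \o f n).
  move=> n0; have := integrableB measurableT (ZlE (l n%:R^-1)^-1 _ (iA _ n0)) (iR _ n0).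
  by apply: eq_integrable => // u _; rewrite /= EFinB.
have intf n : (0 < n)%N -> \int[@lebesgue_measure R]_u f n u =
    (\int[@lebesgue_measure R]_u A n u - nu n%:R^-1) / l n%:R^-1
    - c * (ln n%:R - \sum_(1 <= k < n.+1) k%:R^-1).
  move=> n0; rewrite RintegralB//; [|exact: ZlE (iA _ n0)|exact: iR].
  rewrite RintegralZl//; last exact: iA.
  rewrite RintegralD//; [|exact: ZlE (iK _ n0)|exact: ZlE (iL _ n0)].
  rewrite RintegralZl//; last exact: iK.
  rewrite RintegralZl//; last exact: iL.
  rewrite {2 3}/Rintegral (proj2 (integral_occupancy_kernel R n0)).
  rewrite (proj2 (integral_occupancy_kernel_ln R n0))/=.
  by ring.
have f0 : \int[@lebesgue_measure R]_u f n u @[n --> \oo] --> 0.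
  (* [dominated_cvg] asks for the bound at every index, while it holds only from [N] on. *)
  rewrite -(cvg_shiftn N).
  suff : (\int[@lebesgue_measure R]_u (f (n + N)%N u)%:E)%E @[n --> \oo] --> 0%E.
    by move/fine_cvg.
  have Nn n : (1 < n + N)%N by have [] := HN (n + N)%N (leq_addl _ _).
  rewrite -(integral0 (@lebesgue_measure R) setT).
  apply: (@dominated_cvg _ _ _ (@lebesgue_measure R) setT measurableT
    (fun n => EFin \o f (n + N)%N) (cst 0%E)
    (fun u => ((C + 2 * `|c|) * (54 * expR 2) * exponential_pdf 1 u)%:E)).
  - by move=> n; apply: measurable_int (if_ _ _); apply: ltnW.
  - move=> u _.
    suff fu0 : f n u @[n --> \oo] --> 0.
      apply/cvg_EFin; first by near=> n.
      by rewrite (cvg_shiftn N (f^~ u)).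
    have [u0|u0] := leP u 0.
      rewrite (_ : f^~ u = cst 0); first exact: cvg_cst.
      by apply/funext => n; rewrite fE /occupancy_kernel ltNge u0/= mul0r.
    have h0 : (nu (u ^+ 2 / n%:R) - nu n%:R^-1) / l n%:R^-1 - c * ln (u ^+ 2)
        @[n --> \oo] --> 0.
      rewrite -(subrr (c * ln (u ^+ 2))); apply: cvgB; last exact: cvg_cst.
      apply: (cvg_comp _ _ y0n (haan (u ^+ 2) _)); exact: exprn_gt0.
    have u21 : 0 < 2 * u + 1 by lra.
    (* For fixed [u] the kernel is at most [2 * u] for all [n > 1], so it is enough that the bracket
       falls below [e / (2 * u + 1)]. *)
    apply/cvgr0Pnorm_lt => e e0; near=> n.
    rewrite fE normrM ger0_norm ?occupancy_kernel_ge0//.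
    apply: (@le_lt_trans _ _ (2 * u * (e / (2 * u + 1)))); last first.
      by rewrite mulrA ltr_pdivrMr// mulrC ltr_pM2l//; lra.
    apply: ler_pM => //; first exact: occupancy_kernel_ge0.
      apply: (le_trans (occupancy_kernel_le u _)); first by near: n; exact: nbhs_infty_gt.
      rewrite gtr0_norm// -[leRHS]mulr1 ler_wpM2l//; first by lra.
      by rewrite -expR0 ler_expR oppr_le0 divr_ge0// sqr_ge0.
    apply/ltW; near: n; apply: (cvgr0_norm_lt _ h0); exact: divr_gt0.
  - by [].
  - exact/ZlE/integrable_exponential_pdf.
  - move=> n u _; rewrite /= lee_fin.
    have [n1 [l0 hb]] := HN (n + N)%N (leq_addl _ _).
    have [u0|u0] := leP u 0.
      rewrite fE /occupancy_kernel ltNge u0/= mul0r normr0.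
      by rewrite !mulr_ge0 ?addr_ge0 ?mulr_ge0 ?expR_ge0 ?exponential_pdf_ge0.
    rewrite fE normrM ger0_norm ?occupancy_kernel_ge0//.
    apply: (@le_trans _ _ ((C + 2 * `|c|) *
       (occupancy_kernel (n + N)%N u * (u^-1 + u + u ^+ 2)))); last first.
      rewrite -mulrA ler_wpM2l ?occupancy_kernel_dominated//.
      by rewrite addr_ge0// mulr_ge0.
    rewrite mulrCA ler_wpM2l ?occupancy_kernel_ge0//.
    (* The increment contributes [C], and [ln (u ^+ 2) = 2 * ln u] with [|ln u| <= u^-1 + u]
       contributes [2 * |c|]. *)
    apply: (le_trans (ler_normB _ _)).
    rewrite [leRHS]mulrDl; apply: lerD; first exact: hb.
    rewrite normrM lnXn// normrMn (mulrC 2) -mulrA ler_wpM2l//.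
    by have := normr_ln_le u0; have := sqr_ge0 u; lra.
have lim := cvgB f0 (cvgM (@cvg_cst R c nat \oo _) (@euler_gamma_cvg R)).
rewrite sub0r in lim.
have E : {near \oo, (fun n => \int[@lebesgue_measure R]_u f n u -
    c * (\sum_(1 <= k < n.+1) k%:R^-1 - ln n%:R)) =1
    (fun n => (\int[@lebesgue_measure R]_u A n u - nu n%:R^-1) / l n%:R^-1)}.
  near=> n; rewrite intf; last by near: n; exact: nbhs_infty_gt.
  by ring.
apply: (cvg_trans (near_eq_cvg E)); exact: lim.
Unshelve. all: by end_near.
Qed.

(** * Random frequencies *)

Lemma nneseries_EFin_cvg (R : realType) (f : nat -> R) (a : R) :
  \sum_(j < N) f j @[N --> \oo] --> a -> (\sum_(j <oo) (f j)%:E = a%:E)%E.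
Proof.
move=> fa; apply: cvg_lim => //.
apply/cvg_EFin; first by near=> n; rewrite sumEFin.
apply: cvg_trans fa; apply: near_eq_cvg; near=> n.
by rewrite /= sumEFin/= big_mkord.
Unshelve. all: by end_near.
Qed.

(** This turns the number of distinct values into a series of indicators over species. Its partial
    sums are constant once [N] exceeds every entry of [s]. *)
Lemma size_undup_nneseries (R : realType) (s : seq nat) :
  ((size (undup s))%:R%:E = \sum_(j <oo) ((j \in s)%:R%:E : \bar R))%E.
Proof.
symmetry; apply: nneseries_EFin_cvg; apply: cvg_near_cst.
near=> N; rewrite -natr_sum; congr (_%:R).
have sN j : j \in s -> (j < N)%N.
  move=> js; apply: (@leq_ltn_trans (\max_(i <- s) i)).
    by rewrite leq_bigmax_seq.
  by near: N; exact: nbhs_infty_gt.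
have /perm_size -> : perm_eq (undup s) [seq j <- iota 0 N | j \in s].
  apply: uniq_perm; [exact: undup_uniq|by rewrite filter_uniq// iota_uniq|].
  move=> j; rewrite mem_undup mem_filter mem_iota/= add0n.
  by apply/idP/andP => [js|[]//]; split=> //; exact: sN.
rewrite size_filter -sum1_count [RHS]big_mkcond/=.
rewrite -(big_mkord xpredT (fun j => (j \in s) : nat)) /index_iota subn0.
by apply: eq_bigr => j _; case: (_ \in _).
Unshelve. all: by end_near.
Qed.

(** * Probability that a species is missed or seen *)

Section occupancy.
Context (d : measure_display) (T : measurableType d) (R : realType).
Variables (P : probability T R) (w : nat -> T -> R) (X : nat -> T -> nat).
Hypothesis rfw : random_frequencies P w.
Hypothesis ciX : cond_iid P w X.

Let mw j : measurable_fun setT (w j). Proof. by case: rfw => + _; exact. Qed.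
Let w_gt0 j om : 0 < w j om.
Proof. by case: rfw => _ [/(_ j om)/andP[]]. Qed.
Let w_lt1 j om : w j om < 1.
Proof. by case: rfw => _ [/(_ j om)/andP[]]. Qed.
Let w_ge0 j om : 0 <= w j om. Proof. exact: ltW. Qed.
Let w_sum1 : {ae P, forall om, \sum_(j < N) w j om @[N --> \oo] --> (1 : R)}.
Proof. by case: rfw => _ []. Qed.
Let mX i j : measurable [set om | X i om = j]. Proof. by case: ciX. Qed.

(** [cond_iid] evaluates only fully prescribed draws. These mixed events, with [m] prescribed draws
    followed by [k] draws that miss [j], allow an induction on [k]. *)
Let avoid (m : nat) (js : nat -> nat) (j k : nat) : set T :=
  [set om | (forall i, (i < m)%N -> X i om = js i) /\
            (forall i, (m <= i < m + k)%N -> X i om <> j)].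

Let measurable_avoid m js j k : measurable (avoid m js j k).
Proof.
rewrite (_ : avoid m js j k =
   \bigcap_(i in [set i | (i < m)%N]) [set om | X i om = js i] `&`
   \bigcap_(i in [set i | (m <= i < m + k)%N]) ~` [set om | X i om = j]); last first.
  by apply/seteqP; split=> om [].
apply: measurableI; first by apply: bigcap_measurableType => i _.
by apply: bigcap_measurableType => i _; exact: measurableC.
Qed.

(** The conditional probability of [avoid m js j k] given the frequencies. *)
Let a m (js : nat -> nat) j k om := \prod_(i < m) w (js i) om * (1 - w j om) ^+ k.

Let a_ge0 m js j k om : 0 <= a m js j k om.
Proof.
rewrite mulr_ge0//; first by apply: prodr_ge0.
by rewrite exprn_ge0// subr_ge0 ltW.
Qed.

Let measurable_a m js j k : measurable_fun setT (a m js j k).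
Proof.
apply: measurable_funM; first exact: measurable_prod.
apply: measurable_funX; exact: measurable_funB.
Qed.

Let upd (js : nat -> nat) m v := fun i => if i == m then v else js i.

Let aS m js j k v om : a m.+1 (upd js m v) j k om = a m js j k om * w v om.
Proof.
rewrite /a big_ord_recr/= {2}/upd eqxx mulrAC; congr (_ * _ * _).
apply: eq_bigr => i _; rewrite /upd ifN//.
by rewrite neq_ltn ltn_ord.
Qed.

(** The first unprescribed draw has some value [v] other than [j]; recording it in [js] trades one
    avoiding draw for a prescribed one. *)
Let avoidS m js j k : avoid m js j k.+1 =
  \bigcup_v (if v == j then set0 else avoid m.+1 (upd js m v) j k).
Proof.
apply/seteqP; split=> om.
  move=> [h1 h2]; exists (X m om) => //; rewrite ifN; last first.
    by apply/eqP; apply: h2; rewrite leqnn addnS ltnS leq_addr.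
  split=> i; last by rewrite addSnnS => /andP[/ltnW mi im]; apply: h2; rewrite mi.
  rewrite ltnS leq_eqVlt /upd => /predU1P[->|im]; first by rewrite eqxx.
  by rewrite ifN ?h1// neq_ltn im.
move=> [v _]; case: ifPn => // vj [h1 h2]; split.
  by move=> i im; rewrite h1 ?(ltn_trans im)// /upd ifN// neq_ltn im.
move=> i /andP[]; rewrite leq_eqVlt => /predU1P[<- _|mi im].
  by rewrite h1// /upd eqxx; exact/eqP.
by apply: h2; rewrite mi addSnnS.
Qed.

Let avoid_prob m js j k : P (avoid m js j k) = (\int[P]_om (a m js j k om)%:E)%E.
Proof.
elim: k m js => [m js|k ih m js].
  have := ciX.2 m js 0%N (fun=> setT) (fun=> measurableT).
  rewrite (_ : [set om | forall k, _] = setT); last by apply/seteqP; split.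
  under [in X in _ -> _ = X]eq_integral do rewrite /a expr0 mulr1.
  move=> <-; congr (P _); apply/seteqP; split=> om [h1 h2]; split => //.
  by move=> i; rewrite addn0 => /andP[/leq_ltn_trans h /h]; rewrite ltnn.
rewrite avoidS measure_bigcup//=; last 2 first.
- by move=> v _; case: ifP.
- apply/trivIsetP => v1 v2 _ _ v12; case: ifPn => _; first by rewrite set0I.
  case: ifPn => _; first by rewrite setI0.
  apply/seteqP; split=> // om [[h1 _] [h2 _]].
  move/eqP: v12; apply; have := h1 m (ltnSn _); rewrite h2//.
  by rewrite /upd eqxx.
rewrite (@eq_eseriesl _ _ xpredT); last by move=> v; rewrite in_setT.
transitivity (\sum_(v <oo) \int[P]_om
    (a m js j k om * (if v == j then 0 else w v om))%:E)%E.
  apply: eq_eseriesr => v _; case: ifPn => _.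
    by rewrite measure0; under eq_integral do rewrite mulr0; rewrite integral0.
  by rewrite ih; under eq_integral do rewrite aS.
rewrite -integral_nneseries//; last 2 first.
- move=> v; apply/measurable_EFinP/measurable_funM => //.
  by case: (v == j).
- by move=> v om _; rewrite lee_fin mulr_ge0//; case: ifPn.
(* Summing [w v] over [v] other than [j] gives [1 - w j], but only almost surely. *)
apply: ae_eq_integral => //.
- apply: ge0_emeasurable_sum => [v om _ _|v _].
    by rewrite lee_fin mulr_ge0//; case: ifPn.
  apply/measurable_EFinP/measurable_funM => //.
  by case: (v == j).
- exact/measurable_EFinP/measurable_a.
- apply: filterS w_sum1 => om w1 _; apply: nneseries_EFin_cvg.
  rewrite (_ : a m js j k.+1 om = a m js j k om * (1 - w j om)); last first.
    by rewrite /a exprSr mulrA.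
  under eq_fun do rewrite -mulr_sumr.
  apply: cvgM; first exact: cvg_cst.
  have lim := cvgB w1 (@cvg_cst R (w j om) nat \oo _).
  have E : {near \oo, (fun N => \sum_(v < N) w v om - w j om) =1
      (fun N => \sum_(v < N) if v == j :> nat then 0 else w v om)}.
    near=> N; have jN : (j < N)%N by near: N; exact: nbhs_infty_gt.
    rewrite (bigD1 (Ordinal jN))//= [RHS](bigD1 (Ordinal jN))//= eqxx add0r.
    rewrite addrAC subrr add0r; apply: eq_bigr => v vj.
    by rewrite ifN.
  by apply: (cvg_trans (near_eq_cvg E)); exact: lim.
Unshelve. all: by end_near.
Qed.

Let hit n j : set T := [set om | j \in [seq X i om | i <- iota 0 n]].

Let hitE n j : hit n j = ~` avoid 0 id j n.
Proof.
apply/seteqP; split=> om.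
  move=> /mapP[i]; rewrite mem_iota/= add0n => ni ji [_ /(_ i)].
  by rewrite add0n => /(_ ni); apply.
move=> h; apply: contrapT => jX; apply: h; split=> // i.
rewrite add0n/= => ni Xj; apply: jX; apply/mapP; exists i => //.
by rewrite mem_iota.
Qed.

Let measurable_hit n j : measurable (hit n j).
Proof. by rewrite hitE; apply: measurableC. Qed.

Let int_cst (r : R) : (\int[P]_om r%:E = r%:E)%E.
Proof.
rewrite integral_cst// -[RHS]mule1; congr (_ * _)%E; exact: probability_setT.
Qed.

Let hit_prob n j : P (hit n j) = (\int[P]_om (1 - (1 - w j om) ^+ n)%:E)%E.
Proof.
have aE om : a 0 id j n om = (1 - w j om) ^+ n by rewrite /a big_ord0 mul1r.
have le1 om : (1 - w j om) ^+ n <= 1.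
  by rewrite exprn_ile1 ?subr_ge0 ?(ltW (w_lt1 _ _))// lerBlDr lerDl.
rewrite hitE probability_setC// avoid_prob.
under eq_integral do rewrite aE.
(* Splitting 1 into nonnegative integrands replaces a subtraction by additivity; the second integral
   is finite and can be cancelled. *)
have -> : (1 = \int[P]_om ((1 - (1 - w j om) ^+ n)%:E + ((1 - w j om) ^+ n)%:E))%E.
  under eq_integral do rewrite -EFinD subrK.
  by rewrite int_cst.
have m1 : measurable_fun setT (fun om => ((1 - w j om) ^+ n)%:E).
  by rewrite -(funext (fun om => congr1 EFin (aE om))); apply/measurable_EFinP.
rewrite ge0_integralD//.
- rewrite addeK// fin_num_abs gee0_abs; last first.
    apply: integral_ge0 => om _; rewrite lee_fin exprn_ge0// subr_ge0.
    exact: ltW.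
  apply: (@le_lt_trans _ _ 1%E); last exact: ltry.
  rewrite -(int_cst 1).
  by apply: ge0_le_integral => //= om _; rewrite lee_fin// exprn_ge0// subr_ge0 ltW.
- by move=> om _; rewrite lee_fin subr_ge0.
- apply/measurable_EFinP; apply: measurable_funB => //.
  exact/measurable_EFinP.
- by move=> om _; rewrite lee_fin exprn_ge0// subr_ge0 ltW.
Qed.

Lemma integral_Kn n : (\int[P]_om (Kn X n om)%:R%:E =
  \sum_(j <oo) \int[P]_om (1 - (1 - w j om) ^+ n)%:E)%E.
Proof.
transitivity (\int[P]_om \sum_(j <oo) (\1_(hit n j) om)%:E)%E.
  apply: eq_integral => om _; rewrite /Kn size_undup_nneseries.
  apply: eq_eseriesr => j _; rewrite indicE; congr (_%:R%:E); congr nat_of_bool.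
  by apply/idP/idP; rewrite inE.
rewrite integral_nneseries//; last first.
  by move=> j; apply/measurable_EFinP.
apply: eq_eseriesr => j _; rewrite integral_indic// setIT; exact: hit_prob.
Qed.

(** * The tail mean measure: finiteness, monotonicity, growth at 0 *)

Let above (x : R) j om : \bar R := if x <= w j om then 1%E else 0%E.

Let above_ge0 x j om : (0 <= above x j om)%E.
Proof. by rewrite /above; case: ifPn. Qed.

Let measurable_above x j : measurable_fun setT (above x j).
Proof. by apply: measurable_fun_ifT => //; exact: measurable_fun_ler. Qed.

Let measurable_sum_above x :
  measurable_fun setT (fun om => \sum_(j <oo) above x j om)%E.
Proof. by apply: ge0_emeasurable_sum. Qed.

Let tailV x := (\int[P]_om \sum_(j <oo) above x j om)%E.

Let tailVE x : tailV x = (\sum_(j <oo) \int[P]_om above x j om)%E.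
Proof. by rewrite /tailV integral_nneseries. Qed.

Let tailV_ge0 x : (0 <= tailV x)%E.
Proof. by apply: integral_ge0 => om _; apply: nneseries_ge0. Qed.

(** Markov's inequality: the indicator of [x <= w j] is at most [w j / x], and the frequencies sum
    to 1 almost surely. Finiteness is what makes the [fine] in [tail_mean] harmless. *)
Let tailV_le x : 0 < x -> (tailV x <= x^-1%:E)%E.
Proof.
move=> x0; have xi0 : 0 <= x^-1 by rewrite invr_ge0 ltW.
have mxw j : measurable_fun setT (fun om => (x^-1 * w j om)%:E).
  by apply/measurable_EFinP/measurable_funM.
apply: (@le_trans _ _ (\int[P]_om \sum_(j <oo) (x^-1 * w j om)%:E)%E).
  apply: ge0_le_integral => //.
  - by move=> om _; apply: nneseries_ge0.
  - by apply: ge0_emeasurable_sum => // j om _ _; rewrite lee_fin mulr_ge0.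
  - move=> om _; apply: lee_nneseries => // j _.
    rewrite /above; case: ifPn => [xw|_]; rewrite lee_fin ?mulr_ge0//.
    by rewrite mulrC ler_pdivlMr// mul1r.
rewrite (@ae_eq_integral _ _ _ P setT (cst x^-1%:E))//.
- by rewrite int_cst.
- by apply: ge0_emeasurable_sum => // j om _ _; rewrite lee_fin mulr_ge0.
- apply: filterS w_sum1 => om w1 _; apply: nneseries_EFin_cvg.
  under eq_fun do rewrite -mulr_sumr.
  have := cvgM (@cvg_cst R x^-1 nat \oo _) w1; rewrite mulr1; apply.
Qed.

Let tailV_fin x : 0 < x -> tailV x \is a fin_num.
Proof.
by move=> x0; rewrite ge0_fin_numE// (le_lt_trans (tailV_le x0))// ltry.
Qed.

Let tailVK x : 0 < x -> (tail_mean P w x)%:E = tailV x.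
Proof. by move=> x0; rewrite -[RHS]fineK// tailV_fin. Qed.

Lemma tail_mean_ge0 x : 0 < x -> 0 <= tail_mean P w x.
Proof. by move=> x0; rewrite -lee_fin tailVK. Qed.

Lemma tail_mean_le x y : 0 < x -> x <= y -> tail_mean P w y <= tail_mean P w x.
Proof.
move=> x0 xy; rewrite -lee_fin !tailVK//; last exact: lt_le_trans xy.
apply: ge0_le_integral => //.
- by move=> om _; apply: nneseries_ge0.
- move=> om _; apply: lee_nneseries => // j _; rewrite /above.
  case: ifPn => [yw|_]; last by case: ifPn.
  by rewrite ifT// (le_trans xy).
Qed.

(** All frequencies are positive, so any given number [N] of them exceed a small enough level with
    probability above 1/2 each. The tail mean at that level is then at least [N / 2]. *)
Lemma tail_mean_unbounded x : 0 < x ->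
  exists2 y, 0 < y < x & tail_mean P w x < tail_mean P w y.
Proof.
move=> x0; set M := tail_mean P w x.
have M0 : 0 <= M by exact: tail_mean_ge0.
(* Chosen so that [N / 2 = Num.bound M] is strictly above [M]. *)
pose N := (2 * Num.bound M)%N.
have mF y j : measurable [set om | y <= w j om].
  rewrite -[X in measurable X]setTI; apply: measurable_fun_ler => //.
have half j : \forall k \near \oo,
    (2^-1%:E < P [set om | (k.+1%:R^-1 <= w j om)%R])%E.
  pose F k := [set om | (k.+1%:R^-1 <= w j om)%R].
  have FT : \bigcup_k F k = setT.
    apply/seteqP; split=> // om _.
    have [k hk] := filter_ex (near_infty_natSinv_lt (PosNum (w_gt0 j om))).
    by exists k => //; exact: ltW.
  have : (P \o F) k @[k --> \oo] --> 1%:E.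
    rewrite -(@probability_setT _ _ _ P) -FT.
    apply: nondecreasing_cvg_mu; [by move=> k; exact: mF|by rewrite FT|].
    move=> k k' kk'; apply/subsetPset => om /=; apply: le_trans.
    by rewrite lef_pV2 ?posrE ?ltr0n// ler_nat.
  move=> /fine_cvg /cvgr_gt /(_ 2^-1) h.
  have {}h := h ltac:(lra).
  by apply: filterS h => k; rewrite -lte_fin fineK//; exact/fin_num_measure/mF.
have [k [kx Hk]] : exists k, k.+1%:R^-1 < x /\
    forall j : 'I_N, (2^-1%:E < P [set om | (k.+1%:R^-1 <= w j om)%R])%E.
  have all_half : \forall k \near \oo, forall j : 'I_N,
      (2^-1%:E < P [set om | (k.+1%:R^-1 <= w j om)%R])%E.
    by apply: (@filter_forall nat 'I_N) => j; exact: half.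
  have x_gt : \forall k \near \oo, k.+1%:R^-1 < x.
    exact: (near_infty_natSinv_lt (PosNum x0)).
  by have [k] := filter_ex (filterI x_gt all_half); exists k.
have k0 : 0 < k.+1%:R^-1 :> R by rewrite invr_gt0 ltr0n.
exists k.+1%:R^-1; first by rewrite k0.
rewrite -lte_fin (tailVK k0) tailVE.
apply: (@lt_le_trans _ _ (\sum_(0 <= j < N) \int[P]_om above k.+1%:R^-1 j om)%E); last first.
  by apply: nneseries_lim_ge => *; exact: integral_ge0.
apply: (@lt_le_trans _ _ (\sum_(0 <= j < N) 2^-1%:E)%E).
  rewrite sumEFin lte_fin sumr_const_nat subn0 -[ltRHS]mulr_natl /N natrM.
  by have := archi_boundP M0; lra.
rewrite !big_mkord; apply: lee_sum => j _; apply/ltW/(lt_le_trans (Hk j)).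
rewrite -[X in P X]setIT -integral_indic//.
rewrite le_eqVlt; apply/orP; left; apply/eqP; apply: eq_integral => om _.
rewrite /above indicE; case: ifPn => [kw|/negP kw].
  by rewrite mem_set.
by rewrite memNset.
Qed.

(** * Tonelli: the expected occupancy as a kernel integral *)

Section tonelli.
Variable n : nat.
Hypothesis n_gt0 : (0 < n)%N.
Local Notation mu := (@lebesgue_measure R).

Let term j om u : R := if u ^+ 2 / n%:R <= w j om then occupancy_kernel n u else 0.

Let measurable_kernel : measurable_fun setT (@occupancy_kernel R n).
Proof.
by apply/measurable_EFinP; apply: measurable_int (integral_occupancy_kernel R n_gt0).1.
Qed.

Let measurable_term j : measurable_fun setT (fun p : T * R => (term j p.1 p.2)%:E).
Proof.
apply/measurable_EFinP; apply: measurable_fun_ifT => //.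
  apply: measurable_fun_ler.
    apply: measurable_funM => //; apply: measurable_funX; exact: measurable_snd.
  by apply: measurableT_comp => //; exact: measurable_fst.
by apply: measurableT_comp => //; exact: measurable_snd.
Qed.

Let term_ge0 j om u : 0 <= term j om u.
Proof. by rewrite /term; case: ifPn => // _; exact: occupancy_kernel_ge0. Qed.

Let sum_term u : (\sum_(j <oo) \int[P]_om (term j om u)%:E)%E =
  (occupancy_kernel n u * tail_mean P w (u ^+ 2 / n%:R))%:E.
Proof.
(* At [u = 0] the expected count is infinite and [tailVK] fails, but the kernel vanishes for
   [u <= 0]. *)
have [u0|u0] := leP u 0.
  have k0 : occupancy_kernel n u = 0 by rewrite /occupancy_kernel ltNge u0.
  rewrite k0 mul0r eseries0// => j _ _.
  by rewrite integral0_eq// => om _; rewrite /term k0 if_same.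
rewrite EFinM tailVK; last by rewrite divr_gt0 ?exprn_gt0 ?ltr0n.
rewrite tailVE -nneseriesZl//; last by move=> j _; exact: integral_ge0.
apply: eq_eseriesr => j _.
rewrite -ge0_integralZl//; last by rewrite lee_fin occupancy_kernel_ge0.
apply: eq_integral => om _; rewrite /term /above.
by case: ifPn => _; rewrite ?mule1 ?mule0.
Qed.

(** [integral_occupancy_kernel_le] writes each [1 - (1 - w j) ^+ n] as an integral over [u]. As
    [term] is nonnegative, the expectation and then the sum over species can be moved inside that
    integral, where [sum_term] recognises the tail mean. *)
Let tonelli_Kn :
  measurable_fun setT (fun u => (occupancy_kernel n u * tail_mean P w (u ^+ 2 / n%:R))%:E) /\
  (\int[P]_om (Kn X n om)%:R%:E =
   \int[mu]_u (occupancy_kernel n u * tail_mean P w (u ^+ 2 / n%:R))%:E)%E.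
Proof.
have mG j : measurable_fun setT (fun u => \int[P]_om (term j om u)%:E)%E.
  have := @measurable_fun_fubini_tonelli_G _ _ T _ R P
    (fun p : T * R => (term j p.1 p.2)%:E) (measurable_term j).
  by apply=> p; rewrite lee_fin.
split.
  under eq_fun do rewrite -sum_term.
  apply: ge0_emeasurable_sum => // j u _ _.
  by apply: integral_ge0 => om _; rewrite lee_fin.
rewrite integral_Kn.
transitivity (\sum_(j <oo) \int[P]_om \int[mu]_u (term j om u)%:E)%E.
  apply: eq_eseriesr => j _; apply: eq_integral => om _.
  by rewrite (integral_occupancy_kernel_le n_gt0 _).2// w_gt0 ltW.
transitivity (\sum_(j <oo) \int[mu]_u \int[P]_om (term j om u)%:E)%E.
  apply: eq_eseriesr => j _.
  apply: (@fubini_tonelli _ _ _ _ _ P mu (fun p : T * R => (term j p.1 p.2)%:E)).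
    exact: measurable_term.
  by move=> p; rewrite lee_fin.
rewrite -integral_nneseries//; last first.
  by move=> j u _; apply: integral_ge0 => om _; rewrite lee_fin.
by apply: eq_integral => u _; rewrite sum_term.
Qed.

Let kernel_tail_mean_ge0 u : 0 <= occupancy_kernel n u * tail_mean P w (u ^+ 2 / n%:R).
Proof.
have [u0|u0] := leP u 0; first by rewrite /occupancy_kernel ltNge u0 mul0r.
rewrite mulr_ge0 ?occupancy_kernel_ge0// tail_mean_ge0//.
by rewrite divr_gt0 ?exprn_gt0 ?ltr0n.
Qed.

(** The integrand is nonnegative and integrates to the expectation of [Kn X n], which is at most
    [n]. *)
Lemma integrable_kernel_tail_mean : mu.-integrable setT
  (EFin \o (fun u => occupancy_kernel n u * tail_mean P w (u ^+ 2 / n%:R))).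
Proof.
have [mf E] := tonelli_Kn; apply/integrableP; split=> //.
under eq_integral do rewrite /= ger0_norm ?kernel_tail_mean_ge0//.
rewrite -E; apply: (@le_lt_trans _ _ n%:R%:E); last exact: ltry.
apply: (@le_trans _ _ (\int[P]_om (n%:R%:E))%E); last first.
  by rewrite int_cst.
apply: ge0_le_integral => //.
- under eq_fun do rewrite /Kn size_undup_nneseries.
  apply: ge0_emeasurable_sum => // j _; apply/measurable_EFinP.
  rewrite (_ : (fun _ => _) = \1_(hit n j)) //.
  apply/funext => om; rewrite indicE; congr (_%:R); congr nat_of_bool.
  by apply/idP/idP; rewrite inE.
- move=> om _; rewrite lee_fin ler_nat /Kn (leq_trans (size_undup _))//.
  by rewrite size_map size_iota.
Qed.

Lemma EK_kernel : EK P X n =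
  \int[mu]_u (occupancy_kernel n u * tail_mean P w (u ^+ 2 / n%:R)).
Proof. by rewrite /EK tonelli_Kn.2. Qed.
End tonelli.
End occupancy.

(** * The asymptotic expansion of the expected occupancy *)

Theorem theorem1 (d : measure_display) (T : measurableType d) (R : realType)
  (P : probability T R) (w : nat -> T -> R) (X : nat -> T -> nat)
  (l : R -> R) (c : R) :
  random_frequencies P w ->
  cond_iid P w X ->
  slowly_varying0 l ->
  0 <= c ->
  (forall lam : R, 0 < lam ->
     (fun x => (tail_mean P w (lam * x) - tail_mean P w x) / l x)
       @ at_right (0:R) --> c * ln lam) ->
  (fun n : nat => EK P X n - (tail_mean P w (inv_nat R n) - c * euler_gamma R * l (inv_nat R n)))
    =o_\oo (fun n : nat => l (inv_nat R n)).
Proof.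
move=> rfw ciX svl _ haan.
have lim := de_haan_kernel_cvg (tail_mean_le rfw) (tail_mean_ge0 rfw)
  (tail_mean_unbounded rfw) svl haan
  (fun n n0 => integrable_kernel_tail_mean rfw ciX n0).
(* Eventual nonvanishing of [l] makes the little-o equivalent to the limit of the quotient. *)
have lN0 : \forall n \near \oo, l (inv_nat R n) != 0.
  exact: (@cvg_invn_at_right0 R _ (slowly_varying0_neq0 svl)).
apply/eqoP => e e0; near=> n.
have l0 : l (inv_nat R n) != 0 by near: n.
rewrite (EK_kernel rfw ciX); last by near: n; exact: nbhs_infty_gt.
have h : `|- (c * euler_gamma R) - (\int[@lebesgue_measure R]_u
    (occupancy_kernel n u * tail_mean P w (u ^+ 2 / n%:R)) -
    tail_mean P w (inv_nat R n)) / l (inv_nat R n)| <= e.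
  by near: n; exact: (cvgr_dist_le _ _ lim).
rewrite -ler_pdivrMr ?normr_gt0// -normfV -normrM -normrN.
apply: le_trans h; rewrite le_eqVlt; apply/orP; left; apply/eqP; congr `|_|.
by field.
Unshelve. all: by end_near.
Qed.
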